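(* Let $\mathcal{H}$ be a Hilbert space of finite dimension $d$, and let $\mathcal{C}$ be a nonempty set of subspaces of $\mathcal{H}$, identified with the set of orthogonal projectors $\{Q_V : V\in\mathcal{C}\}$. Then the following are equivalent: (i) $\mathcal{C}$ satisfies $MSAP(d-1)$; (ii) $\mathcal{C}$ satisfies MSAP; (iii) $\mathrm{co}(\mathcal{C}^+)=\mathrm{co}(\overline{\mathcal{C}^+})$; (iv) $\mathcal{C}^+$ is closed.
   Context: $\mathcal{H}$ is a (real or complex) Hilbert space and $\mathcal{B}(\mathcal{H})$ is its algebra of bounded linear operators. A set $\mathcal{C}$ of closed subspaces of $\mathcal{H}$ has the Minimum Subspace Approximation Property (MSAP) if for every finite subset $F\subset\mathcal{H}$ there exists an element of $\mathcal{C}$ that minimizes $e(F,V)=\sum_{f\in F}d^2(f,V)$ over all $V\in\mathcal{C}$, where $d(f,V)$ is the distance from $f$ to $V$. It has $MSAP(k)$ if this holds for all finite subsets $F$ of cardinality at most $k$. A subspace $V$ is identified with the orthogonal projector $Q_V=I-P_V$, where $P_V$ is the orthogonal projector onto $V$ (so $\ker Q_V=V$); the set of projectors $\{Q_V:V\in\mathcal{C}\}$ is again denoted $\mathcal{C}$. $\mathcal{P}^+(\mathcal{H})$ is the set of non-negative self-adjoint operators in $\mathcal{B}(\mathcal{H})$, and $\mathcal{C}^+=\mathcal{C}+\mathcal{P}^+(\mathcal{H})=\{Q+N: Q\in\mathcal{C},\ N\in\mathcal{P}^+(\mathcal{H})\}$. $\mathrm{co}(E)$ is the convex hull of $E$.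 Closures and closedness are with respect to the weak operator topology on $\mathcal{B}(\mathcal{H})$. *)

(* Defs.v *)
From HB Require Import structures.
From mathcomp Require Import all_boot all_order all_algebra finmap.
From mathcomp Require Import all_classical all_reals all_analysis.
From mathcomp Require Import complex.

Set Implicit Arguments.
Unset Strict Implicit.
Unset Printing Implicit Defensive.

Import Order.TTheory GRing.Theory Num.Theory.
Import numFieldNormedType.Exports.

Local Open Scope classical_set_scope.
Local Open Scope ring_scope.

Inductive scalar_kind := RealScalars | ComplexScalars.

Definition scalar_field (R : realType) (k : scalar_kind) : numFieldType :=
  match k with RealScalars => R | ComplexScalars => R[i] end.

Definition scalar_conj (R : realType) (k : scalar_kind) :
    {rmorphism scalar_field R k -> scalar_field R k} :=
  match k return {rmorphism scalar_field R k -> scalar_field R k} with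
  | RealScalars => @idfun R
  | ComplexScalars => @Num.conj R[i]
  end.

Definition scalar_re (R : realType) (k : scalar_kind) : scalar_field R k -> R :=
  match k return scalar_field R k -> R with
  | RealScalars => id
  | ComplexScalars => @complex.Re R
  end.

(* A finite-dimensional Hilbert space is a [vectType] with a positive definite
   hermitian form, linear in its first argument. Every linear subspace is then
   closed and every linear operator is bounded, so [{vspace H}] is the type of
   closed subspaces and ['End(H)] is the algebra of bounded operators. *)
Section HilbertSpace.
Context (R : realType) (k : scalar_kind).
Let K := scalar_field R k.
Context (H : vectType K) (form : {dot H for scalar_conj R k}).

Definition hnorm (x : H) : R := Num.sqrt (scalar_re (form x x)).

Definition dist (f : H) (V : {vspace H}) : R :=
  inf [set hnorm (f - v) | v in [set v | v \in V]].

Definition approx_error (F : {fset H}) (V : {vspace H}) : R :=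
  \sum_(f <- F) dist f V ^+ 2.

Definition minimizes (C : set {vspace H}) (F : {fset H}) (V : {vspace H}) :=
  C V /\ forall W, C W -> approx_error F V <= approx_error F W.

Definition MSAP (C : set {vspace H}) :=
  forall F : {fset H}, exists V, minimizes C F V.

Definition MSAP_card (n : nat) (C : set {vspace H}) :=
  forall F : {fset H}, (#|` F| <= n)%N -> exists V, minimizes C F V.

Definition orth_proj (V : {vspace H}) : 'End(H) :=
  daddv_pi V (orthov form V).

Definition projQ (V : {vspace H}) : 'End(H) := \1%VF - orth_proj V.

Definition nonneg_selfadjoint : set 'End(H) :=
  [set N : 'End(H) | (forall x y, form (N x) y = form x (N y)) /\
                     (forall x, 0 <= form (N x) x)].

Definition Cplus (C : set {vspace H}) : set 'End(H) :=
  [set projQ V + N | V in C & N in nonneg_selfadjoint].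

(* The weak operator topology: the coarsest one making every
   T |-> <T x, y> continuous. *)
Definition wot_eval (T : 'End(H)) : {ptws H * H -> K} :=
  fun xy => form (T xy.1) xy.2.

Definition wot : Type := initial_topology wot_eval.

HB.instance Definition _ := Topological.copy wot (initial_topology wot_eval).

(* Weights are taken in [0, 1] for the order of the scalar field, in which
   only real scalars are comparable with 0. *)
Definition convex_hull (E : set 'End(H)) : set 'End(H) :=
  smallest (@convex_set K 'End(H)) E.

End HilbertSpace.

(* Main.v *)
From HB Require Import structures.
Require Import Defs.
From mathcomp Require Import all_boot all_order all_algebra finmap.
From mathcomp Require Import all_classical all_reals all_analysis.
From mathcomp Require Import complex ring.

Set Implicit Arguments.
Unset Strict Implicit.
Unset Printing Implicit Defensive.

Import Order.TTheory GRing.Theory Num.Theory.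
Import numFieldNormedType.Exports.

Local Open Scope classical_set_scope.
Local Open Scope ring_scope.

(** Write [Q_V] for the projector with kernel [V]. The error of approximation of
    [F] by [V] is the sum of the [<Q_V f, f>] over [f] in [F], a quantity linear
    in [Q_V]; moreover [V <= W] if and only if [Q_V - Q_W] is non-negative. All
    four conditions turn out to be equivalent to

      (P) every [V] such that [Q_V] is a limit of projectors [Q_W], [W] in [C],
          is contained in some member of [C]  ([dominates_limits]).

    Limits are taken along ultrafilters. In finite dimension every family of
    projectors converges along every ultrafilter, and the limit is again a
    projector ([wcvg_projQ]): the entries [<Q_V x, y>] are bounded, and the
    expansion of vectors in an orthogonal basis turns [Q_V Q_V = Q_V] into a
    finite sum of products, which passes to the limit. Hence a limit of operators
    [Q_V + N] has the form [Q_{V0} + N0] with [Q_{V0}] a limit of projectors of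
    [C] ([closure_Cplus]). Under (P), [V0 <= W] for some [W] in [C], so this
    operator lies above [Q_W], and [C^+] is closed
    ([dominates_limits_closed]).

    MSAP(d-1) gives (P) ([MSAP_dominates_limits]). If [V] is not the whole space,
    let [F] be a basis of [V], of at most [d - 1] vectors; the error of
    approximation of [F] is [0] at the limit [V], so the infimum over [C] is [0],
    and a minimizer contains [F]. If [V] is the whole space, then projectors of [C]
    tend to [0]; the entries of a nonzero projector cannot all be small, so the
    whole space belongs to [C] ([closure_fullv]).

    Equality of the convex hulls gives (P) ([convex_hull_dominates_limits]):
    if [Q_V] is a convex combination of elements [Q_W + N] of [C^+], one of
    these [W] has a positive weight, and the vectors [x] with [<Q_V x, x> = 0]
    satisfy [<Q_W x, x> = 0], hence lie in [W].

    Conversely, if [C^+] is closed, MSAP holds ([closed_MSAP]): the limit of a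
    minimizing family is some [Q_{V0}] in [C^+], which lies above [Q_W] for some
    [W] in [C], and the error of [W] is at most that of [V0]. *)

(** * Scalars: the real and the complex case *)

Lemma cvg_scalarP (K : numFieldType) (I : Type) (U : set_system I)
    (g : I -> K) (l : K) : Filter U ->
  g @ U --> l <-> forall e, 0 < e -> \forall i \near U, `|l - g i| < e.
Proof. by move=> FU; exact: (@cvgrPdist_lt K K^o). Qed.

Section Scalars.
Context (R : realType).
Implicit Types k : scalar_kind.

(** Approximation errors are reals, values of the form are scalars; this embedding
    compares the two. *)
Definition scalar_of_real k : R -> scalar_field R k :=
  match k return R -> scalar_field R k with
  | RealScalars => id
  | ComplexScalars => @real_complex R
  end.

Lemma scalar_of_realD k : {morph scalar_of_real k : x y / x + y}.
Proof. by case: k => x y //=; rewrite raddfD. Qed.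

Lemma scalar_of_real0 k : scalar_of_real k 0 = 0.
Proof. by case: k. Qed.

Lemma ler_scalar_of_real k x y :
  (scalar_of_real k x <= scalar_of_real k y) = (x <= y).
Proof. by case: k => //=; exact: lecR. Qed.

Lemma scalar_reK k (z : scalar_field R k) :
  0 <= z -> scalar_of_real k (scalar_re z) = z.
Proof.
by case: k z => //= -[a b]; rewrite lecE /= => /andP[/eqP -> _].
Qed.

Lemma norm_scalar_conj k (z : scalar_field R k) : `|scalar_conj R k z| = `|z|.
Proof. by case: k z => //= z; exact: norm_conjC. Qed.

Lemma scalar_conjK k : involutive (scalar_conj R k).
Proof. by case: k => //= z; exact: conjCK. Qed.

Lemma mulr_scalar_conj k (z : scalar_field R k) :
  z * scalar_conj R k z = `|z| ^+ 2.
Proof.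
case: k z => /= z; last by rewrite -normCK.
by rewrite real_normK ?num_real// expr2.
Qed.

Lemma scalar_conj_ge0 k (z : scalar_field R k) :
  0 <= z -> scalar_conj R k z = z.
Proof. by case: k z => // z z0; exact: geC0_conj. Qed.

Lemma ultra_fmap (I T : Type) (g : I -> T) (U : set_system I) :
  UltraFilter U -> UltraFilter (g @ U).
Proof.
move=> UU; split=> [|G pG gUG]; first exact: fmap_proper_filter.
apply/seteqP; split=> [A GA|]; last exact: gUG.
have [//|nA] := in_ultra_setVsetC (g @^-1` A) UU.
have GnA : G (~` A) by apply: gUG.
by have /filter_ex[x []] : G (A `&` ~` A) by exact: filterI.
Qed.

Lemma ultra_cvg_real (I : Type) (U : set_system I) (g : I -> R) (M : R) :
  UltraFilter U -> (forall i, `|g i| <= M) -> exists l : R, g @ U --> l.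
Proof.
move=> UU gM.
have UgU := ultra_fmap g UU.
have := @segment_compact R (- M) M; rewrite compact_ultra /=.
have gMU : (g @ U) `[- M, M]%classic.
  by apply: (@filterE _ U) => i /=; rewrite in_itv /= -ler_norml.
by move=> cpt; have [l [_ gl]] := cpt _ UgU gMU; exists l.
Qed.

(** Bolzano-Weierstrass along an ultrafilter. For complex scalars the real and the
    imaginary part converge separately. *)
Lemma ultra_cvg_scalar k (I : Type) (U : set_system I)
    (g : I -> scalar_field R k) (M : scalar_field R k) :
  UltraFilter U -> (forall i, `|g i| <= M) ->
  exists l : scalar_field R k, g @ U --> l.
Proof.
move=> UU; case: k g M => /= g M gM.
  by have [l gl] := @ultra_cvg_real I U g M UU gM; exists l.
have leC (x : R) (z : R[i]) : x%:C%C <= z -> x <= complex.Re z.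
  by rewrite lecE => /andP[].
have ReM i : `|complex.Re (g i)| <= complex.Re M.
  by apply: leC; apply: le_trans (gM i); exact: normc_ge_Re.
have ImM i : `|complex.Im (g i)| <= complex.Re M.
  rewrite -normrN -ReiNIm; apply: leC; apply: le_trans (gM i).
  apply: le_trans (normc_ge_Re _) _; rewrite normrM.
  have -> : `|'i%C : R[i]| = 1 by rewrite normc_def /= expr0n add0r expr1n sqrtr1.
  by rewrite mulr1.
have [a ga] := ultra_cvg_real UU ReM.
have [b gb] := ultra_cvg_real UU ImM.
exists (a +i* b)%C; apply/(@cvg_scalarP (scalar_field R ComplexScalars)) => e e0.
have ee : (complex.Re e)%:C%C = e by apply: RRe_real; rewrite realE ltW.
have Re0 : 0 < complex.Re e / 2.
  by rewrite divr_gt0// -ltcR ee.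
move/cvgrPdist_lt: ga => /(_ _ Re0) ga; move/cvgrPdist_lt: gb => /(_ _ Re0) gb.
near=> i.
have -> : (a +i* b)%C - g i =
    (a - complex.Re (g i))%:C%C + 'i%C * (b - complex.Im (g i))%:C%C.
  by rewrite [LHS]complexE /=; case: (g i).
apply: le_lt_trans (ler_normD _ _) _; rewrite normrM.
have -> : `|'i%C : R[i]| = 1 by rewrite normc_def /= expr0n add0r expr1n sqrtr1.
rewrite mul1r !normc_def /= expr0n addr0 addr0 !sqrtr_sqr.
rewrite -ee -rmorphD ltcR [ltRHS]splitr ltrD //.
  by near: i.
by near: i.
Unshelve. all: by end_near.
Qed.

End Scalars.

(** * Limits of scalars and pointwise topologies *)

Section ScalarLimits.
Context (K : numFieldType) (I : Type) (U : set_system I).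

Lemma cvg_scalar_unique {PU : ProperFilter U} (g : I -> K) (a b : K) :
  g @ U --> a -> g @ U --> b -> a = b.
Proof. by move=> ga gb; apply: (cvg_unique (@norm_hausdorff K K^o) ga gb). Qed.

(** The order of the scalars may be partial; non-negativity passes to the limit
    because it is the closed condition [a = `|a|]. *)
Lemma cvg_scalar_ge0 {PU : ProperFilter U} (g : I -> K) (a : K) :
  (\forall i \near U, 0 <= g i) -> g @ U --> a -> 0 <= a.
Proof.
move=> g0 ga.
suff -> : a = `|a| by [].
apply: (cvg_scalar_unique ga); apply: cvg_trans (cvg_norm (ga : _ --> (a : K^o))).
apply: near_eq_cvg; near=> i; rewrite ger0_norm //.
by near: i.
Unshelve. all: by end_near.
Qed.

Lemma cvg_scalar_le {PU : ProperFilter U} (g h : I -> K) (a b : K) :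
  (\forall i \near U, g i <= h i) -> g @ U --> a -> h @ U --> b -> a <= b.
Proof.
move=> gh ga hb; rewrite -subr_ge0.
apply: (@cvg_scalar_ge0 _ (h \- g)); last exact: (@cvgB K K^o).
by apply: filterS gh => i /=; rewrite subr_ge0.
Qed.

Lemma cvg_scalar_sum (J : Type) {FU : Filter U} (s : seq J)
    (g : J -> I -> K) (a : J -> K) : (forall j, g j @ U --> a j) ->
  \sum_(j <- s) g j i @[i --> U] --> \sum_(j <- s) a j.
Proof.
move=> ga; elim: s => [|j s IH].
  by rewrite big_nil; under eq_fun do rewrite big_nil; exact: cvg_cst.
rewrite big_cons; under eq_fun do rewrite big_cons.
exact: cvgD (ga j : _ --> (a j : K^o)) IH.
Qed.

End ScalarLimits.

Lemma cvg_scalar_conj (R : realType) k (I : Type) (U : set_system I)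
    {FU : Filter U} (g : I -> scalar_field R k) a :
  g @ U --> a -> scalar_conj R k (g i) @[i --> U] --> scalar_conj R k a.
Proof.
move=> /cvg_scalarP ga; apply/cvg_scalarP => e e0.
near=> i; rewrite -rmorphB norm_scalar_conj; near: i; exact: ga.
Unshelve. all: by end_near.
Qed.

Lemma cvg_initial (S : choiceType) (T : topologicalType) (f : S -> T)
    (F : set_system S) (s : S) : Filter F ->
  F --> (s : initial_topology f) <-> f @ F --> f s.
Proof.
move=> FF; split=> [Fs B /(@initial_continuous _ _ f s) nB | fF B].
  exact: Fs.
rewrite (@nbhsE (initial_topology f)) => -[_ [[A oA <-] As] AB].
apply: filterS AB _; apply: fF; exact: open_nbhs_nbhs.
Qed.

Lemma cvg_ptwsP (I : Type) (T : topologicalType) (F : set_system (I -> T))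
    (f : I -> T) : Filter F ->
  {ptws, F --> f} <-> forall i, g i @[g --> F] --> f i.
Proof.
move=> FF; rewrite cvg_sup; split=> Ff i.
  exact: ((cvg_initial (fun g : I -> T => g i) f FF).1 (Ff i)).
exact: ((cvg_initial (fun g : I -> T => g i) f FF).2 (Ff i)).
Qed.

(** * Orthogonal expansions *)

Section Geometry.
Context (R : realType) (k : scalar_kind).
Let K := scalar_field R k.
Context (H : vectType K) (form : {dot H for scalar_conj R k}).
Local Notation "''[' u , v ]" := (form u v).
Implicit Types (x y u v : H) (V W : {vspace H}) (T : 'End(H)).

Lemma formC x y : '[x, y] = scalar_conj R k '[y, x].
Proof. by rewrite (hermC form) expr0 mul1r. Qed.

Lemma formC_eq0 x y : '[x, y] = 0 -> '[y, x] = 0.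
Proof. by move=> xy; rewrite formC xy rmorph0. Qed.

Lemma form_eq0 x : ('[x, x] == 0) = (x == 0).
Proof.
apply/eqP/eqP => [|->]; last by rewrite linear0l.
by apply: contra_eq => /(neq0_dnorm_gt0 (s := form)) /gt_eqF ->.
Qed.

Lemma form_ge0 x : 0 <= '[x, x].
Proof.
have [->|/(neq0_dnorm_gt0 (s := form))/ltW//] := eqVneq x 0.
by rewrite linear0l.
Qed.

Lemma form_pythagoras x y : '[x, y] = 0 -> '[x + y, x + y] = '[x, x] + '[y, y].
Proof.
by move=> xy; rewrite linearDl !linearDr /= xy (formC_eq0 xy) addr0 add0r.
Qed.

(** A weak form of the Cauchy-Schwarz inequality, from [0 <= <x - t y, x - t y>] for
    the scalar [t] of modulus one that makes [<x, t y>] equal to [`|<x, y>|]. *)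
Lemma norm_form_le x y : `|'[x, y]| <= '[x, x] + '[y, y].
Proof.
have [->|xy0] := eqVneq '[x, y] 0; first by rewrite normr0 addr_ge0 ?form_ge0.
pose t := '[x, y] / `|'[x, y]|.
have n0 : `|'[x, y]| != 0 by rewrite normr_eq0.
have tt : t * scalar_conj R k t = 1.
  by rewrite mulr_scalar_conj /t normrM normfV normr_id divff ?expr1n.
have txy : scalar_conj R k t * '[x, y] = `|'[x, y]|.
  have -> : '[x, y] = t * `|'[x, y]| by rewrite /t divfK.
  rewrite mulrA [_ * t]mulrC tt mul1r normrM normr_id.
  have -> : `|t| = 1 by rewrite /t normrM normfV normr_id divff.
  by rewrite mul1r.
have tyx : t * '[y, x] = `|'[x, y]|.
  by rewrite -[LHS]scalar_conjK rmorphM /= -formC txy scalar_conj_ge0.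
clearbody t.
have := form_ge0 (x - t *: y).
have -> : '[x - t *: y, x - t *: y] =
    '[x, x] - scalar_conj R k t * '[x, y]
      - (t * '[y, x] - t * scalar_conj R k t * '[y, y]).
  rewrite linearBl !linearBr /= !linearZl_LR !linearZr_LR /=.
  by congr (_ - _ - (_ - _)); exact: mulrCA.
rewrite txy tyx tt mul1r.
have -> : '[x, x] - `|'[x, y]| - (`|'[x, y]| - '[y, y])
        = ('[x, x] + '[y, y]) - `|'[x, y]| *+ 2 by rewrite mulr2n; ring.
rewrite subr_ge0; apply: le_trans.
by rewrite mulr2n lerDl.
Qed.

(** The expansion formula in an orthogonal basis, taken as a definition because it is
    the form in which orthogonal bases serve below: it yields projections, the form as
    a sum of products of coordinates, and operators from their entries. *)
Definition frame (e : seq H) V :=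
  {subset e <= V} /\
  forall x, x \in V -> x = \sum_(u <- e) ('[x, u] / '[u, u]) *: u.

(** The expansion of a vector outside [V] still gives its orthogonal projection
    onto [V]. *)
Lemma frame_residual e V x y : frame e V -> y \in V ->
  '[x - \sum_(u <- e) ('[x, u] / '[u, u]) *: u, y] = 0.
Proof.
move=> [_ eE] yV; rewrite linearBl /= {1}(eE y yV) linear_sumr linear_sumlz /=.
rewrite -sumrB big1_seq // => u /andP[_ ue].
rewrite linearZr_LR linearZl_LR /=.
rewrite fmorph_div /= -!formC; apply/eqP; rewrite subr_eq0; apply/eqP.
by rewrite [in RHS]mulrAC mulrC mulrA.
Qed.

(** Gram-Schmidt: the vector added to the frame is the component of the next generator
    orthogonal to the previous ones, unless it is zero. *)
Lemma frame_exists V : exists e, frame e V.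
Proof.
suff : forall s : seq H, exists e, frame e << s >>%VS.
  by move=> /(_ (vbasis V)); rewrite (span_basis (vbasisP V)).
elim=> [|x s [e [eV eE]]].
  by exists [::]; split=> // x; rewrite span_nil memv0 big_nil => /eqP.
pose p := \sum_(u <- e) ('[x, u] / '[u, u]) *: u.
have pV : p \in << s >>%VS.
  by rewrite /p big_seq; apply: memv_suml => u ue; rewrite memvZ ?eV.
have sub : (<< s >> <= << x :: s >>)%VS by rewrite span_cons addvSr.
have orth y : y \in << s >>%VS -> '[x - p, y] = 0 by exact: frame_residual.
have [xp|xp] := eqVneq x p.
  have <- : << s >>%VS = << x :: s >>%VS; last by exists e; split.
  by apply/esym; rewrite span_cons; apply/addv_idPr; rewrite -memvE xp.
exists ((x - p) :: e); split=> [u|y].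
  rewrite inE => /predU1P[->|/eV us]; last by apply: (subvP sub).
  by apply: memvB; [rewrite memv_span ?mem_head | exact: (subvP sub)].
rewrite span_cons => /memv_addP[_ /vlineP[a ->] [z zs ->]].
rewrite big_cons.
have nz : '[x - p, x - p] != 0 by rewrite form_eq0 subr_eq0.
have -> : a *: x + z = a *: (x - p) + (a *: p + z).
  by rewrite scalerBr addrA subrK.
set w := a *: p + z.
have ws : w \in << s >>%VS by rewrite memvD ?memvZ.
clearbody w.
rewrite linearDl linearZl_LR /= (formC_eq0 (orth _ ws)) addr0 mulfK //.
congr (_ + _); rewrite [LHS](eE w ws); apply: eq_big_seq => u /eV us.
by rewrite linearDl linearZl_LR /= orth // mulr0 add0r.
Qed.

End Geometry.

(** * The projectors and the approximation error *)

Section Projections.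
Context (R : realType) (k : scalar_kind).
Let K := scalar_field R k.
Context (H : vectType K) (form : {dot H for scalar_conj R k}).
Local Notation "''[' u , v ]" := (form u v).
Local Notation Q := (projQ form).
Implicit Types (x y u v w f : H) (V W : {vspace H}) (T : 'End(H)).

Lemma sub_lfunE T1 T2 x : (T1 - T2) x = T1 x - T2 x.
Proof. by rewrite add_lfunE opp_lfunE. Qed.

Lemma capv_orthov V : (V :&: orthov form V = 0)%VS.
Proof.
apply/eqP; rewrite -subv0; apply/subvP => x /memv_capP[xV /mem_orthovP xo].
by rewrite memv0 -(form_eq0 form) xo.
Qed.

Lemma addv_orthov V : (V + orthov form V = fullv)%VS.
Proof.
apply/eqP; rewrite eqEsubv subvf /=; apply/subvP => x _.
have [e eV] := frame_exists form V.
pose p := \sum_(u <- e) ('[x, u] / '[u, u]) *: u.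
have -> : x = p + (x - p) by rewrite addrC subrK.
apply: memv_add.
  by rewrite /p big_seq; apply: memv_suml => u /eV.1 uV; rewrite memvZ.
by apply/mem_orthovP => v vV; exact: frame_residual eV vV.
Qed.

Lemma projQE V x : Q V x = daddv_pi (orthov form V) V x.
Proof.
rewrite /projQ /orth_proj sub_lfunE id_lfunE; apply/eqP.
by rewrite subr_eq addrC daddv_pi_add ?capv_orthov ?addv_orthov ?memvf.
Qed.

Lemma projQ_mem V x : x - Q V x \in V.
Proof.
rewrite /projQ /orth_proj sub_lfunE id_lfunE opprB addrC subrK.
exact: memv_pi.
Qed.

Lemma projQ_orth V x v : v \in V -> '[Q V x, v] = 0.
Proof. by rewrite projQE; apply/mem_orthovP/memv_pi. Qed.

Lemma projQ_unique V x w :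
  x - w \in V -> {in V, forall v, '[w, v] = 0} -> Q V x = w.
Proof.
move=> xwV wo; apply/eqP; rewrite -subr_eq0 -(form_eq0 form).
have qwV : Q V x - w \in V.
  by rewrite -[Q V x - w](subrKA x) addrC -[Q V x - x]opprB memvB ?projQ_mem.
by rewrite {1}linearBl /= projQ_orth // wo // subrr.
Qed.

Lemma projQ_eq0 V x : (Q V x == 0) = (x \in V).
Proof.
apply/eqP/idP => [q0|xV]; first by rewrite -[x]subr0 -q0 projQ_mem.
by apply: projQ_unique; rewrite ?subr0 // => v _; rewrite linear0l.
Qed.

Lemma projQ_idem V x : Q V (Q V x) = Q V x.
Proof.
apply: projQ_unique => [|v]; last exact: projQ_orth.
by rewrite subrr mem0v.
Qed.

Lemma form_projQ V x y : '[Q V x, y] = '[Q V x, Q V y].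
Proof.
rewrite -[in LHS](subrK (Q V y) y) linearDr /= projQ_orth ?add0r //.
exact: projQ_mem.
Qed.

Lemma projQ_adj V x y : '[Q V x, y] = '[x, Q V y].
Proof. by rewrite form_projQ [RHS]formC [in RHS]form_projQ -formC. Qed.

Lemma projQ_nonneg V : nonneg_selfadjoint form (Q V).
Proof. by split=> [|x]; [exact: projQ_adj | rewrite form_projQ form_ge0]. Qed.

Lemma projQ_contract V x : '[Q V x, x] <= '[x, x].
Proof.
rewrite -[in leRHS](subrK (Q V x) x) addrC form_pythagoras.
  by rewrite form_projQ lerDl form_ge0.
by rewrite projQ_orth ?projQ_mem.
Qed.

Lemma nonneg_selfadjointD T1 T2 : nonneg_selfadjoint form T1 ->
  nonneg_selfadjoint form T2 -> nonneg_selfadjoint form (T1 + T2).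
Proof.
move=> [a1 p1] [a2 p2]; split=> [x y|x].
  by rewrite !add_lfunE linearDl linearDr /= a1 a2.
by rewrite add_lfunE linearDl /= addr_ge0.
Qed.

Lemma nonneg_selfadjointZ (a : K) T : 0 <= a ->
  nonneg_selfadjoint form T -> nonneg_selfadjoint form (a *: T).
Proof.
move=> a0 [sa p]; split=> [x y|x].
  by rewrite !scale_lfunE linearZl_LR linearZr_LR /= sa scalar_conj_ge0.
by rewrite scale_lfunE linearZl_LR /= mulr_ge0.
Qed.

(** If [V <= W] then [Q_W = Q_W Q_V], and [Q_W] is a contraction. *)
Lemma projQ_anti V W : (V <= W)%VS -> nonneg_selfadjoint form (Q V - Q W).
Proof.
move=> VW; split=> [x y|x].
  by rewrite !(sub_lfunE (Q V)) linearBl linearBr /= !projQ_adj.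
rewrite (sub_lfunE (Q V)) linearBl /= subr_ge0.
have e : Q W x = Q W (Q V x).
  apply/eqP; rewrite -subr_eq0 -linearB /= projQ_eq0.
  exact: (subvP VW) (projQ_mem V x).
rewrite [leLHS]form_projQ [leRHS]form_projQ e -form_projQ.
exact: projQ_contract.
Qed.

Lemma projQ_selfadjoint_idem T :
  (forall x y, '[T x, y] = '[x, T y]) -> (forall x, T (T x) = T x) ->
  Q (lker T) = T.
Proof.
move=> sa idem; apply/lfunP => x; apply: projQ_unique.
  by rewrite memv_ker linearB /= idem subrr.
by move=> v; rewrite memv_ker sa => /eqP ->; rewrite linear0r.
Qed.

Lemma CplusP (C : set {vspace H}) T : Cplus form C T <->
  exists2 V, C V & nonneg_selfadjoint form (T - Q V).
Proof.
split=> [[V CV [N Nn <-]]|[V CV Nn]].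
  by exists V => //; rewrite addrAC subrr add0r.
by exists V => //; exists (T - Q V) => //; rewrite addrC subrK.
Qed.

Lemma projQ_Cplus (C : set {vspace H}) V : C V -> Cplus form C (Q V).
Proof.
move=> CV; apply/CplusP; exists V => //; rewrite subrr.
by split=> [x y|x]; rewrite !lfunE /= ?linear0l ?linear0r.
Qed.

Lemma sqr_hnorm x : scalar_of_real k (hnorm form x ^+ 2) = '[x, x].
Proof.
have re0 : 0 <= scalar_re '[x, x].
  by rewrite -(ler_scalar_of_real k) scalar_reK ?form_ge0 // scalar_of_real0 form_ge0.
by rewrite /hnorm sqr_sqrtr // scalar_reK ?form_ge0.
Qed.

(** By Pythagoras the distance is attained at the orthogonal projection. *)
Lemma dist_projQ f V : dist form f V = hnorm form (Q V f).
Proof.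
set S := [set hnorm form (f - v) | v in [set v | v \in V]].
have QS : S (hnorm form (Q V f)).
  exists (f - Q V f); first exact: projQ_mem.
  by rewrite opprB addrC subrK.
have Qlb : lbound S (hnorm form (Q V f)).
  move=> _ [v /= vV <-].
  rewrite -(@ler_pXn2r _ 2) ?nnegrE ?sqrtr_ge0 // -(ler_scalar_of_real k).
  rewrite !sqr_hnorm.
  have -> : f - v = Q V f + ((f - Q V f) - v).
    by rewrite addrA addrCA subrr addr0.
  rewrite form_pythagoras; first by rewrite lerDl form_ge0.
  by rewrite projQ_orth // memvB ?projQ_mem.
apply/eqP; rewrite eq_le; apply/andP; split.
  by apply: ge_inf => //; exists (hnorm form (Q V f)).
by apply: lb_le_inf => //; exists (hnorm form (Q V f)).
Qed.

(** The error is linear in the projector, hence weakly continuous. *)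
Lemma approx_errorE (F : {fset H}) V :
  scalar_of_real k (approx_error form F V) = \sum_(f <- F) '[Q V f, f].
Proof.
rewrite /approx_error (big_morph _ (@scalar_of_realD R k) (@scalar_of_real0 R k)).
by apply: eq_bigr => f _; rewrite dist_projQ sqr_hnorm -form_projQ.
Qed.

End Projections.

(** * Limits of operators *)

Section OperatorLimits.
Context (R : realType) (k : scalar_kind).
Let K := scalar_field R k.
Context (H : vectType K) (form : {dot H for scalar_conj R k}).
Local Notation "''[' u , v ]" := (form u v).
Local Notation Q := (projQ form).
Implicit Types (x y u v w f : H) (V W : {vspace H}) (T : 'End(H)).

Definition wcvg (I : Type) (U : set_system I) (F : I -> 'End(H)) T :=
  forall x y, '[F i x, y] @[i --> U] --> '[T x, y].

Lemma form_ext x y : (forall z, '[x, z] = '[y, z]) -> x = y.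
Proof.
move=> e; apply/eqP; rewrite -subr_eq0 -(form_eq0 form).
by rewrite {1}linearBl /= e subrr.
Qed.

Lemma frame_form e V x y : frame form e V -> x \in V ->
  '[x, y] = \sum_(u <- e) '[x, u] / '[u, u] * '[u, y].
Proof.
move=> [_ eE] xV; rewrite {1}(eE x xV) linear_sumlz /=.
by apply: eq_bigr => u _; rewrite linearZl_LR.
Qed.

(** Weak compactness: the limits of the entries in a frame of the whole space are the
    entries of the limit operator. *)
Lemma bounded_wcvg (I : Type) (U : set_system I) (F : I -> 'End(H))
    (M : H -> H -> K) : UltraFilter U ->
  (forall i x y, `|'[F i x, y]| <= M x y) -> exists T, wcvg U F T.
Proof.
move=> UU FM.
have /choice[l lP] : forall xy : H * H, exists l : K,
    '[F i xy.1, xy.2] @[i --> U] --> l.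
  by move=> xy; apply: (ultra_cvg_scalar UU) => i; exact: FM.
have [e ef] := frame_exists form fullv.
pose t x : H := \sum_(u <- e) (l (x, u) / '[u, u]) *: u.
have t_lin : linear t.
  move=> a x y; rewrite /t scaler_sumr -big_split /=; apply: eq_bigr => u _.
  rewrite scalerA -scalerDl mulrA -mulrDl; congr (_ / _ *: _).
  apply: cvg_scalar_unique (lP (_, _)) _ => /=.
  under eq_fun do rewrite linearP linearPl /=.
  apply: (@cvgD K K^o); last exact: (lP (y, u)).
  by apply: (@cvgMl_tmp K); exact: (lP (x, u)).
pose tL : {linear H -> H} := HB.pack t (GRing.isLinear.Build _ _ _ _ t t_lin).
exists (linfun tL) => x y; rewrite lfunE /= /t linear_sumlz /=.
have E i : '[F i x, y] = \sum_(u <- e) '[F i x, u] / '[u, u] * '[u, y].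
  exact: frame_form ef (memvf _).
under eq_fun do rewrite E.
under eq_bigr do rewrite linearZl_LR /=.
apply: cvg_scalar_sum => u.
do 2 apply: (@cvgMr_tmp K).
exact: (lP (x, u)).
Qed.

(** In infinite dimension a weak limit of projectors need not be a projector; here
    [<Q x, Q y>] is a finite sum of products of entries of [Q] in a frame, so that
    [<Q x, y> = <Q x, Q y>] survives in the limit. *)
Lemma wcvg_projQ (I : Type) (U : set_system I) (s : I -> {vspace H}) :
  UltraFilter U -> exists V, wcvg U (fun i => Q (s i)) (Q V).
Proof.
move=> UU.
have [|T sT] := @bounded_wcvg I U (fun i => Q (s i))
    (fun x y => '[x, x] + '[y, y]) UU.
  move=> i x y; apply: le_trans (norm_form_le form _ _) _.
  by rewrite lerD2r -form_projQ projQ_contract.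
have Tsa x y : '[T x, y] = '[x, T y].
  rewrite [RHS]formC; apply: cvg_scalar_unique (sT x y) _.
  under eq_fun do rewrite projQ_adj formC.
  by apply: cvg_scalar_conj; exact: sT.
exists (lker T); rewrite projQ_selfadjoint_idem // => x.
apply: form_ext => y; have [e ef] := frame_exists form fullv.
apply: cvg_scalar_unique _ (sT x y).
have E i : '[Q (s i) x, y] =
    \sum_(u <- e) '[Q (s i) x, u] / '[u, u] * '[Q (s i) u, y].
  rewrite form_projQ (frame_form _ ef (memvf _)).
  by apply: eq_bigr => u _; rewrite -projQ_adj.
under eq_fun do rewrite E.
rewrite Tsa (frame_form _ ef (memvf _)); apply: cvg_scalar_sum => u.
rewrite -Tsa; apply: (@cvgM K); last exact: sT.
by apply: (@cvgMr_tmp K); exact: sT.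
Qed.

Lemma cvg_wotP (U : set_system 'End(H)) T : Filter U ->
  U --> (T : wot form) <-> wcvg U id T.
Proof.
move=> FU; rewrite [X in X <-> _]cvg_initial cvg_ptwsP.
by split=> UT => [x y|[x y]]; [exact: (UT (x, y)) | exact: UT].
Qed.

Lemma closure_wcvg (A : set 'End(H)) T : closure (A : set (wot form)) T ->
  exists U : set_system 'End(H), [/\ UltraFilter U, U A & wcvg U id T].
Proof.
move=> clT; have PF : ProperFilter (within A (nbhs (T : wot form))).
  exact: (@within_nbhs_proper (wot form) A T clT).
have [U [UU FU]] := ultraFilterLemma PF.
exists U; split=> //; first by apply: FU; exact: withinT.
by apply/cvg_wotP => B nB; apply: FU; exact: cvg_within nB.
Qed.

Lemma wcvg_closure (I : Type) (U : set_system I) (F : I -> 'End(H))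
    (A : set 'End(H)) T : ProperFilter U ->
  (\forall i \near U, A (F i)) -> wcvg U F T ->
  closure (A : set (wot form)) T.
Proof.
move=> PU AF FT B nB.
have /(_ _ nB) UB : F @ U --> (T : wot form) by apply/cvg_wotP.
have /filter_ex[i [AFi BFi]] : U ((A \o F) `&` (F @^-1` B)) by exact: filterI.
by exists (F i).
Qed.

Lemma wcvg_nonneg (I : Type) (U : set_system I) (F G : I -> 'End(H)) T1 T2 :
  ProperFilter U -> wcvg U F T1 -> wcvg U G T2 ->
  (\forall i \near U, nonneg_selfadjoint form (F i - G i)) ->
  nonneg_selfadjoint form (T1 - T2).
Proof.
move=> PU F1 G2 FG.
have FGc x y : '[(F i - G i) x, y] @[i --> U] --> '[(T1 - T2) x, y].
  rewrite sub_lfunE linearBl /=.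
  under eq_fun do rewrite sub_lfunE linearBl /=.
  by apply: (@cvgB K K^o); [exact: F1 | exact: G2].
split=> [x y|x].
  rewrite [RHS]formC; apply: cvg_scalar_unique (FGc x y) _.
  apply: cvg_trans (cvg_scalar_conj (FGc y x)).
  apply: near_eq_cvg; near=> i; rewrite -formC.
  by have [-> _] : nonneg_selfadjoint form (F i - G i) by near: i.
apply: cvg_scalar_ge0 (FGc x x); near=> i.
by have [_ ->] : nonneg_selfadjoint form (F i - G i) by near: i.
Unshelve. all: by end_near.
Qed.

End OperatorLimits.

(** * Limits of projectors and the approximation property *)

Section Approximation.
Context (R : realType) (k : scalar_kind).
Let K := scalar_field R k.
Context (H : vectType K) (form : {dot H for scalar_conj R k}).
Local Notation "''[' u , v ]" := (form u v).
Local Notation Q := (projQ form).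
Implicit Types (x y u v w f : H) (V W : {vspace H}) (T S : 'End(H)).
Implicit Type C : set {vspace H}.

(** Choosing, for every [S] in [C^+], a projector of [C] below [S] turns a family in
    [C^+] that converges to [T] into a family of projectors; its limit is below [T]
    because non-negativity passes to the limit. *)
Lemma closure_Cplus C T : closure (Cplus form C : set (wot form)) T ->
  exists V, closure ([set Q W | W in C] : set (wot form)) (Q V) /\
            nonneg_selfadjoint form (T - Q V).
Proof.
move=> /closure_wcvg[U [UU UC UT]].
have /choice[s sP] : forall S, exists W, Cplus form C S ->
    C W /\ nonneg_selfadjoint form (S - Q W).
  move=> S; have [/CplusP[W CW nW]|nS] := pselect (Cplus form C S).
    by exists W.
  (* Outside [C^+] the choice of a subspace is arbitrary. *)
  by exists fullv.
have [V sV] := wcvg_projQ form s UU.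
exists V; split.
  apply: wcvg_closure sV; apply: filterS UC => S /sP[Cs _].
  by exists (s S).
by apply: wcvg_nonneg UT sV _; apply: filterS UC => S /sP[].
Qed.

Lemma Cplus_le C T V W : C W -> nonneg_selfadjoint form (T - Q V) ->
  (V <= W)%VS -> Cplus form C T.
Proof.
move=> CW TV VW; apply/CplusP; exists W; first exact: CW.
rewrite -[T - Q W](subrKA (Q V)); apply: nonneg_selfadjointD TV _.
exact: projQ_anti.
Qed.

Definition dominates_limits C := forall V,
  closure ([set Q W | W in C] : set (wot form)) (Q V) ->
  exists2 W, C W & (V <= W)%VS.

Lemma dominates_limits_closed C :
  dominates_limits C -> closed (Cplus form C : set (wot form)).
Proof.
by move=> dC T /closure_Cplus[V [/dC[W CW VW] TV]]; exact: Cplus_le TV VW.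
Qed.

(** An operator with small entries is a contraction for the norm given by the sum of
    the coordinates: for a fixed point [x], the sum [N] of the [`|<x, w>|] satisfies
    [N <= M * N], where [M < 1] is the sum of the sizes of the entries of [T]. *)
Lemma fixpoint_small_eq0 e T x : frame form e fullv ->
  \sum_(w <- e) \sum_(u <- e) `|'[T u, w] / '[u, u]| < 1 -> T x = x -> x = 0.
Proof.
move=> ef; set M := (X in X < 1) => M1 Tx.
pose N := \sum_(w <- e) `|'[x, w]|.
have NM : N <= M * N.
  rewrite /M mulr_suml; apply: ler_sum => w _.
  have -> : '[x, w] = \sum_(u <- e) '[x, u] * ('[T u, w] / '[u, u]).
    rewrite -[in LHS]Tx {1}(ef.2 x (memvf _)) linear_sum linear_sumlz /=.
    apply: eq_bigr => u _; rewrite linearZ linearZl_LR /=.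
    by rewrite mulrAC mulrA.
  apply: le_trans (ler_norm_sum _ _ _) _; rewrite mulr_suml.
  rewrite big_seq [leRHS]big_seq; apply: ler_sum => u ue.
  rewrite normrM mulrC ler_wpM2l // /N (big_rem u) //=.
  by rewrite lerDl sumr_ge0.
have N0 : 0 <= N by rewrite sumr_ge0.
have {}N0 : N = 0.
  apply/eqP; rewrite eq_le N0 andbT.
  by rewrite -(pmulr_rle0 _ (_ : 0 < 1 - M)) ?subr_gt0 // mulrBl mul1r subr_le0.
rewrite (ef.2 x (memvf _)) big1_seq // => u /andP[_ ue].
have := N0; rewrite /N (big_rem u) //= => /eqP.
rewrite paddr_eq0 ?sumr_ge0 // normr_eq0 => /andP[/eqP -> _].
by rewrite mul0r scale0r.
Qed.

(** The rank cannot drop to zero in the limit: a projector with small entries fixes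
    only [0]. This covers the one case that families of [d - 1] vectors do not
    detect. *)
Lemma closure_fullv C :
  closure ([set Q W | W in C] : set (wot form)) (Q fullv) -> C fullv.
Proof.
move=> /closure_wcvg[U [UU UC UT]].
have [e ef] := frame_exists form fullv.
have Q0 x : Q fullv x = 0 by apply/eqP; rewrite projQ_eq0 memvf.
have c1 w u : `|'[(S : 'End(H)) u, w] / '[u, u]| @[S --> U] --> (0 : K).
  rewrite -[X in _ --> X](normr0 K); apply: (@cvg_norm K K^o).
  rewrite -(mul0r ('[u, u]^-1)); apply: (@cvgMr_tmp K).
  by have := UT u w; rewrite Q0 linear0l.
have c2 w : \sum_(u <- e) `|'[(S : 'End(H)) u, w] / '[u, u]|
    @[S --> U] --> (0 : K).
  by have := cvg_scalar_sum (s := e) (c1 w); rewrite big1 //; apply.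
have cM : \sum_(w <- e) \sum_(u <- e) `|'[(S : 'End(H)) u, w] / '[u, u]|
    @[S --> U] --> (0 : K).
  by have := cvg_scalar_sum (s := e) c2; rewrite big1 //; apply.
have /filter_ex[_ [[W CW <-] QW]] : U ([set Q W | W in C] `&`
    [set S : 'End(H) | \sum_(w <- e) \sum_(u <- e) `|'[S u, w] / '[u, u]| < 1]).
  apply: filterI => //.
  have /cvg_scalarP/(_ 1 ltr01) := cM.
  apply: filterS => S; rewrite sub0r normrN ger0_norm //.
  by rewrite sumr_ge0 // => w _; rewrite sumr_ge0.
suff <- : W = fullv by [].
apply/eqP; rewrite eqEsubv subvf /=; apply/subvP => x _.
rewrite -(projQ_eq0 form); apply/eqP.
exact: (fixpoint_small_eq0 ef QW (projQ_idem form W x)).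
Qed.

(** The error of a basis of [V] tends to [0] along the family, and a subspace whose
    error is [0] contains the basis. *)
Lemma MSAP_dominates_limits C :
  MSAP_card form (\dim {:H}).-1 C -> dominates_limits C.
Proof.
move=> mC V clV; have [Vf|Vf] := eqVneq V fullv.
  by exists fullv; rewrite ?subvf //; apply: closure_fullv; rewrite -Vf.
pose F : {fset H} := [fset x in (vbasis V : seq H)]%fset.
have [|W [CW Wmin]] := mC F.
  have : (\dim V <= (\dim {:H}).-1)%N.
    by have := Vf; rewrite eqEdim subvf -ltnNge; case: (\dim {:H}).
  apply: leq_trans; rewrite -[leqRHS](size_tuple (vbasis V)).
  by rewrite card_fseq size_undup.
exists W => //.
have {}Wmin : \sum_(f <- F) '[Q W f, f] <= 0.
  move/closure_wcvg: clV => [U [UU UC UT]].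
  have limF : \sum_(f <- F) '[(S : 'End(H)) f, f] @[S --> U] -->
      \sum_(f <- F) '[Q V f, f] by apply: cvg_scalar_sum.
  have V0 : \sum_(f <- F) '[Q V f, f] = 0.
    rewrite big1_seq // => f /andP[_]; rewrite in_fset /= => /vbasis_mem.
    by rewrite -(projQ_eq0 form) => /eqP ->; rewrite linear0l.
  rewrite V0 in limF.
  apply: cvg_scalar_le (cvg_cst _) limF.
  apply: filterS UC => _ [W' CW' <-].
  by have := Wmin _ CW'; rewrite -(ler_scalar_of_real k) !approx_errorE.
rewrite -(span_basis (vbasisP V)); apply/span_subvP => f fV.
rewrite -(projQ_eq0 form) -(form_eq0 form) -form_projQ eq_le.
rewrite [X in _ && X](projQ_nonneg form W).2 andbT.
apply: le_trans Wmin; rewrite (big_rem f) /= ?in_fset // lerDl.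
by apply: sumr_ge0 => u _; exact: (projQ_nonneg form W).2.
Qed.

(** The sets of subspaces of [C] with error at most that of a given member of [C] form
    a filter base, because errors are totally ordered; a limit along an ultrafilter
    containing them has an error below that of every member of [C]. *)
Lemma closed_MSAP C : C !=set0 ->
  closed (Cplus form C : set (wot form)) -> MSAP form C.
Proof.
move=> [V1 CV1] cC F.
pose B V := [set V' | C V' /\ approx_error form F V' <= approx_error form F V].
have PB : ProperFilter (filter_from C B).
  apply: filter_from_proper => [|V CV]; last by exists V; split.
  apply: filter_from_filter => [|V W CV CW]; first by exists V1.
  have [VW|/ltW WV] := leP (approx_error form F V) (approx_error form F W).
    by exists V => // V' [CV' V'V]; do 2 split=> //; exact: le_trans VW.
  by exists W => // V' [CV' V'W]; do 2 split=> //; exact: le_trans WV.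
have [U [UU BU]] := ultraFilterLemma PB.
have [V0 UV0] := wcvg_projQ form id UU.
have V0min V : C V -> approx_error form F V0 <= approx_error form F V.
  move=> CV; rewrite -(ler_scalar_of_real k) !approx_errorE.
  have UB : U (B V) by apply: BU; exists V.
  have limF : \sum_(f <- F) '[Q V' f, f] @[V' --> U] -->
    \sum_(f <- F) '[Q V0 f, f] by apply: cvg_scalar_sum => f; exact: UV0.
  apply: cvg_scalar_le limF (cvg_cst _); apply: filterS UB => V' [_].
  by rewrite -(ler_scalar_of_real k) !approx_errorE.
have : Cplus form C (Q V0).
  apply: cC; apply: wcvg_closure UV0.
  apply: filterS (BU _ (ex_intro2 _ _ V1 CV1 (fun _ => id))) => V [CV _].
  exact: projQ_Cplus.
move=> /CplusP[W CW [_ QW]]; exists W; split=> // V CV.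
apply: le_trans (V0min V CV).
rewrite -(ler_scalar_of_real k) !approx_errorE; apply: ler_sum => f _.
by have := QW f; rewrite sub_lfunE linearBl /= subr_ge0.
Qed.

End Approximation.

(** * Convex hulls *)

Section ConvexHull.
Context (R : realType) (k : scalar_kind).
Let K := scalar_field R k.
Context (H : vectType K) (form : {dot H for scalar_conj R k}).
Local Notation "''[' u , v ]" := (form u v).
Local Notation Q := (projQ form).
Implicit Types (C : set {vspace H}) (T : 'End(H)).

(** A convex set containing [C^+]; it contains [Q_V] only if some member of [C]
    contains [V]. For a non-negative [T] the isotropic vectors are those of the kernel,
    but isotropy passes directly from a sum to its terms. *)
Definition isotropic_dominated C : set 'End(H) :=
  [set T | nonneg_selfadjoint form T /\
           exists2 W, C W & forall x, '[T x, x] = 0 -> x \in W].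

Lemma nonnegD_isotropic T1 T2 x : nonneg_selfadjoint form T1 ->
  nonneg_selfadjoint form T2 -> '[(T1 + T2) x, x] = 0 -> '[T1 x, x] = 0.
Proof.
move=> [_ p1] [_ p2] /eqP; rewrite add_lfunE linearDl /=.
by rewrite paddr_eq0 // => /andP[/eqP].
Qed.

Lemma Cplus_isotropic_dominated C : Cplus form C `<=` isotropic_dominated C.
Proof.
move=> _ [V CV [N Nn <-]]; split.
  by apply: nonneg_selfadjointD; first exact: projQ_nonneg.
exists V; first exact: CV.
move=> x /(nonnegD_isotropic (projQ_nonneg form V) Nn) /eqP.
by rewrite form_projQ form_eq0 projQ_eq0.
Qed.

(** A vector isotropic for a sum of non-negative operators is isotropic for each of
    them; so a subspace that works for a summand of positive weight works for the
    combination. *)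
Lemma convex_isotropic_dominated C : convex_set (isotropic_dominated C).
Proof.
apply/convex_setW => T1 T2 /set_mem[n1 [W CW W1]] /set_mem[n2 _] l l0 l1.
apply/mem_set; rewrite /conv /=.
have m1 := nonneg_selfadjointZ (ltW l0) n1.
have m2 : nonneg_selfadjoint form ((1 - l%:num) *: T2).
  by apply: nonneg_selfadjointZ n2; rewrite subr_ge0 ltW.
split; first exact: nonneg_selfadjointD.
exists W; first exact: CW.
move=> x /(nonnegD_isotropic m1 m2) /eqP.
by rewrite scale_lfunE linearZl_LR mulf_eq0 gt_eqF //= => /eqP/W1.
Qed.

Lemma convex_hull_dominates_limits C :
  convex_hull (Cplus form C) =
    convex_hull (closure (Cplus form C : set (wot form))) ->
  dominates_limits form C.
Proof.
move=> hullE V clV.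
have : convex_hull (closure (Cplus form C : set (wot form))) (Q V).
  apply: sub_gen_smallest; apply: closureS clV => _ [W CW <-].
  exact: projQ_Cplus.
rewrite -hullE => /(smallest_sub (@convex_isotropic_dominated C)).
move=> /(_ (@Cplus_isotropic_dominated C))[_ [W CW VW]].
exists W; first exact: CW.
apply/subvP => x; rewrite -(projQ_eq0 form) => /eqP x0; apply: VW.
by rewrite x0 linear0l.
Qed.

End ConvexHull.

(** * Equivalence of the four conditions *)

Theorem theorem2p4 (R : realType) (k : scalar_kind)
    (H : vectType (scalar_field R k)) (form : {dot H for scalar_conj R k})
    (d : nat) (dimH : \dim {:H} = d)
    (C : set {vspace H}) (C_neq0 : C !=set0) :
  [<-> MSAP_card form d.-1 C;
       MSAP form C;
       convex_hull (Cplus form C) =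
         convex_hull (closure (Cplus form C : set (wot form)));
       closed (Cplus form C : set (wot form))].
Proof.
have MSAP_closed : MSAP_card form d.-1 C ->
    closed (Cplus form C : set (wot form)).
  rewrite -dimH => /MSAP_dominates_limits; exact: dominates_limits_closed.
have MSAPW : MSAP form C -> MSAP_card form d.-1 C by move=> mC F _; exact: mC.
have closedM := closed_MSAP C_neq0.
tfae.
- by move=> /MSAP_closed/closedM.
- by move=> /MSAPW/MSAP_closed/closure_id <-.
- by move=> /convex_hull_dominates_limits/dominates_limits_closed.
- by move=> /closedM/MSAPW.
Qed.
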